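(* Let $t\ge 0$ be an integer and let $\epsilon\in\mathbb{R}$ satisfy $0<\epsilon\ll 1$. There exists a digraph $G$ with nonnegative edge costs on $\nu=\nu(t,\epsilon)=\Theta(t/\epsilon)$ vertices such that, for the metric completion $H$ of $G$, the integrality ratio of the level-$t$ Sherali–Adams tightening of the standard (DFJ) LP relaxation of ATSP on $H$ is at least $1+\frac{1-\epsilon}{2t+3}$.
   Context: Metric completion: for a digraph $G=(V,E)$ with nonnegative edge costs $c$, its metric completion is the complete digraph $H$ on $V$ in which the cost $c'(v,w)$ of edge $(v,w)$ is the minimum $c$-cost of a $v$–$w$ dipath in $G$. Standard (DFJ) LP of ATSP on a complete digraph $H=(V,E_H)$: variables $x_e$, $e\in E_H$; minimize $\sum_e c'_e x_e$ subject to $x(\delta^{in}(S))\ge 1$ and $x(\delta^{out}(S))\ge 1$ for all $\emptyset\subsetneq S\subsetneq V$, $x(\delta^{in}(\{v\}))=1$ and $x(\delta^{out}(\{v\}))=1$ for all $v\in V$, and $0\le x\le 1$. Here $\delta^{out}(U)$ ($\delta^{in}(U)$) is the set of edges leaving (entering) $U$ and $x(F)=\sum_{e\in F}x_e$. Let $\hat P$ denote its feasible polytope. Sherali–Adams: let $\hat P\subseteq[0,1]^n$ be a polytope given by a finite system of linear inequalities $\sum_{i=1}^n a_i y_i\ge b$ (the system includes $0\le y_i\le 1$ for all $i$; equations are written as two inequalities). For an integer $t\ge0$, the level-$t$ Sherali–Adams tightening $SA^t(\hat P)$ is the set of vectors $y=(y_S)$ indexed by subsets $S\subseteq\{1,\dots,n\}$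 with $|S|\le t+1$, with $y_\emptyset=1$, such that for every inequality $\sum_i a_i y_i\ge b$ of the system and every pair of disjoint sets $S,Q\subseteq\{1,\dots,n\}$ with $|S|+|Q|\le t$: $\sum_{i=1}^n a_i\sum_{T\subseteq Q}(-1)^{|T|}y_{S\cup T\cup\{i\}}\ \ge\ b\sum_{T\subseteq Q}(-1)^{|T|}y_{S\cup T}$. Integrality ratio of the instance: the minimum cost of a Hamiltonian dicycle in $H$ (w.r.t. $c'$) divided by $\min\{\sum_{e}c'_e\,y_{\{e\}} : y\in SA^t(\hat P)\}$. *)

(* Defs.v *)
From HB Require Import structures.
From mathcomp Require Import all_boot all_order all_algebra.
From mathcomp Require Import reals.
Set Implicit Arguments.
Unset Strict Implicit.
Unset Printing Implicit Defensive.
Import Order.TTheory GRing.Theory Num.Theory.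
Local Open Scope ring_scope.

Definition is_minimum (R : realType) (A : R -> Prop) (m : R) : Prop :=
  A m /\ forall x, A x -> m <= x.

Section SheraliAdams.
Variables (R : realType) (I : finType).

(* [(a, b)] stands for the inequality [\sum_i a i * y_i >= b]. *)
Definition lin_ineq := ({ffun I -> R} * R)%type.

(* Only the values of [y] on sets of at most [t.+1] elements are constrained
   (or read): [y] is a vector indexed by those sets, extended arbitrarily. *)
Definition sherali_adams (t : nat) (sys : seq lin_ineq)
    (y : {set I} -> R) : Prop :=
  y set0 = 1 /\
  forall ab, ab \in sys -> forall S Q : {set I},
    [disjoint S & Q] -> (#|S| + #|Q| <= t)%N ->
    \sum_(i : I) ab.1 i *
        \sum_(T in powerset Q) (-1) ^+ #|T| * y (S :|: T :|: [set i])
      >= ab.2 * \sum_(T in powerset Q) (-1) ^+ #|T| * y (S :|: T).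

Definition ineq_ge (a : {ffun I -> R}) (b : R) : lin_ineq := (a, b).
Definition ineq_le (a : {ffun I -> R}) (b : R) : lin_ineq := (- a, - b).

(* The coefficients of the linear form [x(F)]. *)
Definition indic (F : {set I}) : {ffun I -> R} := [ffun i => (i \in F)%:R].

End SheraliAdams.

Section ATSP.
Variables (R : realType) (V : finType).

(* Edges of the complete digraph on [V]; there are no loops. *)
Definition kedge := {e : V * V | e.1 != e.2}.

Definition delta_out (U : {set V}) : {set kedge} :=
  [set e : kedge | ((val e).1 \in U) && ((val e).2 \notin U)].
Definition delta_in (U : {set V}) : {set kedge} :=
  [set e : kedge | ((val e).1 \notin U) && ((val e).2 \in U)].

Definition dfj_system : seq (lin_ineq R kedge) :=
  let cuts := enum [pred U : {set V} | (U != set0) && (U != [set: V])] in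
  [seq ineq_ge (indic R (delta_in U)) 1 | U <- cuts] ++
  [seq ineq_ge (indic R (delta_out U)) 1 | U <- cuts] ++
  [seq ineq_ge (indic R (delta_in [set v])) 1 | v <- enum V] ++
  [seq ineq_le (indic R (delta_in [set v])) 1 | v <- enum V] ++
  [seq ineq_ge (indic R (delta_out [set v])) 1 | v <- enum V] ++
  [seq ineq_le (indic R (delta_out [set v])) 1 | v <- enum V] ++
  [seq ineq_ge (indic R [set e]) 0 | e <- enum {: kedge}] ++
  [seq ineq_le (indic R [set e]) 1 | e <- enum {: kedge}].

(* [v :: p] lists the vertices of a dipath from [v] to [w]. *)
Definition is_dipath (E : rel V) (v w : V) (p : seq V) : Prop :=
  [/\ path E v p, uniq (v :: p) & last v p = w].

Definition dipath_cost (c : V -> V -> R) (v : V) (p : seq V) : R :=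
  \sum_(a <- pairmap c v p) a.

(* Requiring the minima to exist forces [E] to be strongly connected. *)
Definition metric_completion (E : rel V) (c c' : V -> V -> R) : Prop :=
  forall v w, v != w ->
    is_minimum
      (fun a => exists2 p, is_dipath E v w p & a = dipath_cost c v p)
      (c' v w).

Definition hamiltonian_dicycle (p : seq V) : Prop :=
  ucycle [rel v w | v != w] p /\ size p = #|V|.

Definition dicycle_cost (c' : V -> V -> R) (p : seq V) : R :=
  \sum_(v <- p) c' v (next p v).

Definition sa_cost (c' : V -> V -> R) (y : {set kedge} -> R) : R :=
  \sum_(e : kedge) c' (val e).1 (val e).2 * y [set e].

Definition integrality_ratio (t : nat) (c' : V -> V -> R) (r : R) : Prop :=
  exists opt lp : R,
    [/\ is_minimum
          (fun a => exists2 p, hamiltonian_dicycle p & a = dicycle_cost c' p)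
          opt,
        is_minimum
          (fun a => exists2 y, sherali_adams t dfj_system y & a = sa_cost c' y)
          lp,
        0 < lp
      & r = opt / lp].

End ATSP.

(* Main.v *)
Require Import Defs.
From mathcomp Require Import all_classical reals topology normedtype derive.
From mathcomp Require Import all_boot all_order all_fingroup all_algebra.
From mathcomp Require Import zify ring lra.
Set Implicit Arguments.
Unset Strict Implicit.
Unset Printing Implicit Defensive.
Import Order.TTheory GRing.Theory Num.Theory.
Import numFieldNormedType.Exports.
Local Open Scope ring_scope.

(**
  Take a line of length [m] with two requests to be carried: one from [0] to [m]
  and one from [m] to [0]; each of the points [0..m] must be visited twice (two
  copies of it are vertices).  A tour must, besides carrying the two requests,
  cross every unit gap but at most one in both directions, since two uncrossed
  gaps would isolate the vertices in between; hence it costs at least [4m - 2].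

  The vertices split into two directed cycles of cost [2m], each made of one
  request and one copy of each point, traversed back.  Exchanging the successors
  of the two tails at the [j]-th gap merges the two cycles [X_0] into a
  Hamiltonian dicycle [X_j] of cost [4m - 2], and distinct gaps change the
  successors of disjoint sets of vertices.  With [w = 1 / (t + 2)], the signed
  combination [w * \sum_j X_j + (1 - m w) * X_0] has cost [4m - 2 m w].  It is
  feasible at level [t]: conditioning on [t] edges either excludes [X_0] and
  leaves a nonnegative combination of Hamiltonian dicycles, or keeps [X_0],
  excludes at most [t] of the [X_j], and thus leaves a total weight of at least
  [2 w]; this suffices because each edge of [X_0] is missing from at most one [X_j].
*)

(** * Signed combinations of integral points *)

(** Inclusion-exclusion: the left side expands the product over [i] of one minus the indicator of
    [i \in Q :&: A]. *)
Lemma sum_powerset_sign (R : comNzRingType) (I : finType) (Q A : {set I}) :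
  \sum_(T in powerset Q) (-1) ^+ #|T| * (T \subset A)%:R
    = [disjoint Q & A]%:R :> R.
Proof.
transitivity (\prod_(i : I) (- (i \in Q :&: A)%:R + 1 : R)).
  rewrite bigA_distr big_mkcond /=; apply: eq_bigr => T _.
  rewrite -big_mkcond /= prodrN powersetE.
  have [sTQA|/subsetPn[i iT iQA]] := boolP (T \subset Q :&: A).
    have := sTQA; rewrite subsetI => /andP[-> ->].
    by rewrite big1 // => i /(subsetP sTQA) ->.
  have -> : \prod_(i in T) ((i \in Q :&: A)%:R : R) = 0.
    by rewrite (bigD1 i) //= (negPf iQA) mul0r.
  rewrite mulr0; case: ifP => // sTQ.
  have [sTA|_] := boolP (T \subset A); last by rewrite mulr0.
  by case/negP: iQA; apply/setIP; split; [move: sTQ|move: sTA] => /subsetP; apply.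
have [|nQA] := boolP [disjoint Q & A].
  by rewrite -setI_eq0 => /eqP ->; rewrite big1 // => i _; rewrite inE oppr0 add0r.
have [i iQA] : exists i, i \in Q :&: A by apply/set0Pn; rewrite setI_eq0.
by rewrite (bigD1 i) //= iQA addNr mul0r.
Qed.

Section SignedCombination.
Variables (R : realType) (I : finType).
Implicit Types (ab : lin_ineq R I) (S Q X : {set I}).

Definition slack ab X : R := \sum_(i in X) ab.1 i - ab.2.

(** Each integral point [X k] is lifted to the indicator of its subsets. By inclusion-exclusion, the
    alternating sum over [T] keeps exactly the points that contain [S] and avoid [Q], and by
    linearity the constraint becomes a weighted sum of their slacks. The weights [lam] may be
    negative: only these conditioned sums matter. *)
Lemma sherali_adams_signed (K : finType) (lam : K -> R) (X : K -> {set I})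
    (t : nat) (sys : seq (lin_ineq R I)) :
  \sum_k lam k = 1 ->
  (forall ab, ab \in sys -> forall S Q, (#|S| + #|Q| <= t)%N ->
     0 <= \sum_(k | (S \subset X k) && [disjoint Q & X k])
             lam k * slack ab (X k)) ->
  sherali_adams t sys (fun S => \sum_k lam k * (S \subset X k)%:R).
Proof.
move=> lam1 Hsys; split.
  by rewrite -[RHS]lam1; apply: eq_bigr => k _; rewrite sub0set mulr1.
move=> ab abs S Q _ SQt.
have yE S' : \sum_(T in powerset Q) (-1) ^+ #|T| *
      \sum_k lam k * (S' :|: T \subset X k)%:R
    = \sum_k lam k * (S' \subset X k)%:R * [disjoint Q & X k]%:R :> R.
  rewrite (eq_bigr (fun T : {set I} => \sum_k lam k * (S' \subset X k)%:R *
            ((-1) ^+ #|T| * (T \subset X k)%:R))); last first.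
    move=> T _; rewrite mulr_sumr; apply: eq_bigr => k _.
    by rewrite subUset -mulnb natrM; ring.
  rewrite exchange_big; apply: eq_bigr => k _ /=.
  by rewrite -mulr_sumr sum_powerset_sign.
rewrite yE -subr_ge0.
rewrite (eq_bigr (fun i => \sum_k ab.1 i *
    (lam k * (S :|: [set i] \subset X k)%:R * [disjoint Q & X k]%:R))); last first.
  move=> i _; rewrite -mulr_sumr -yE; congr (_ * _); apply: eq_bigr => T _.
  by congr (_ * _); apply: eq_bigr => k _; rewrite setUAC.
rewrite exchange_big mulr_sumr -sumrB /=.
have := Hsys ab abs S Q SQt; rewrite big_mkcond /=.
rewrite (eq_bigr (fun k => (if (S \subset X k) && [disjoint Q & X k] then
            lam k * slack ab (X k) else 0))) // => H.
apply: le_trans H _; apply: ler_sum => k _.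
rewrite (eq_bigr (fun i => (lam k * (S \subset X k)%:R * [disjoint Q & X k]%:R) *
     (if i \in X k then ab.1 i else 0))); last first.
  move=> i _; rewrite subUset sub1set -mulnb natrM.
  by case: (i \in X k) => /=; ring.
rewrite -mulr_sumr -big_mkcond /= /slack.
by case: (S \subset X k); case: [disjoint Q & X k] => /=;
  rewrite le_eqVlt; apply/orP; left; apply/eqP; ring.
Qed.

(* If [S] and [Q] do not exclude [X0], they exclude at most [t] of the [X j], so
   the remaining signed sum of slacks is [w * (\sum_(j in B) slack (X j))] plus
   [(1 - #|J| w) * slack X0], where [#|B| >= #|J| - t] and [w * t.+2 = 1]. *)
Lemma sherali_adams_star (J : finType) (X0 : {set I}) (X : J -> {set I})
    (t : nat) (sys : seq (lin_ineq R I)) :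
  (t.+2 <= #|J|)%N ->
  (forall i j k, (i \in X j) != (i \in X0) -> (i \in X k) != (i \in X0) -> j = k) ->
  (forall ab, ab \in sys -> forall j, 0 <= slack ab (X j)) ->
  (forall ab, ab \in sys -> slack ab X0 <= 0 \/
     forall B : {set J},
       \sum_(j in B) (slack ab X0 - slack ab (X j)) <= 2 * slack ab X0) ->
  sherali_adams t sys (fun S => t.+2%:R^-1 * \sum_j (S \subset X j)%:R
     + (1 - #|J|%:R / t.+2%:R) * (S \subset X0)%:R).
Proof.
move=> tJ Xdisj Xge0 X0slack.
pose w : R := t.+2%:R^-1.
have w_gt0 : 0 < w by rewrite invr_gt0.
have w2 : t.+2%:R * w = 1 by rewrite mulfV // pnatr_eq0.
pose lam (k : option J) := if k is Some _ then w else 1 - #|J|%:R * w.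
pose Y k := if k is Some j then X j else X0.
have big_opt (P : pred (option J)) (F : option J -> R) :
    \sum_(k | P k) F k = (if P None then F None else 0) + \sum_(j | P (Some j)) F (Some j).
  rewrite big_mkcond /= (bigD1 None) //=; congr (_ + _).
  rewrite [RHS]big_mkcond /= (reindex_omap Some id) /=; last by case.
  by apply: eq_bigl => j; rewrite eqxx.
suff [y0 yP] : sherali_adams t sys (fun S => \sum_k lam k * (S \subset Y k)%:R).
  have yE S : \sum_k lam k * (S \subset Y k)%:R = w * \sum_j (S \subset X j)%:R
     + (1 - #|J|%:R * w) * (S \subset X0)%:R.
    by rewrite big_opt /= addrC mulr_sumr.
  split; first by rewrite -yE.
  move=> ab abs S Q dSQ SQt; move: (yP ab abs S Q dSQ SQt).
  congr (_ * _ <= _); last apply: eq_bigr => i _; last congr (_ * _);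
    by apply: eq_bigr => T _; rewrite yE.
apply: sherali_adams_signed.
  by rewrite big_opt /= sumr_const -[w *+ _]mulr_natl; ring.
move=> ab abs S Q SQt; rewrite big_opt /=.
have X_ge0 (P : pred J) : 0 <= \sum_(j | P j) w * slack ab (X j).
  by apply: sumr_ge0 => j _; rewrite mulr_ge0 ?Xge0 // ltW.
case: ifP => [/andP[SX0 QX0]|_]; last by rewrite add0r.
have w_le0 : 1 - #|J|%:R * w <= 0 by rewrite subr_le0 -[X in X <= _]w2 ler_pM2r ?ler_nat.
(* When [slack ab X0] is nonpositive, its product with the nonpositive weight of [X0] is
   harmless. *)
have [s0|sB] := X0slack ab abs.
  by rewrite addr_ge0 // mulr_le0.
pose B := [set j | (S \subset X j) && [disjoint Q & X j]].
have sB0 : 0 <= slack ab X0 by have := sB set0; rewrite big_set0; lra.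
(* As [X0] contains [S] and avoids [Q], each excluded [j] has an element of [S :|: Q] on which [X j]
   and [X0] disagree. By [Xdisj] this element determines [j], so [f] is injective on the excluded
   indices. *)
have hB : (#|~: B| <= t)%N.
  apply: leq_trans SQt.
  pose f j := [pick i in S :|: Q | (i \in X j) != (i \in X0)].
  have fP j : j \in ~: B -> exists2 i, f j = Some i &
      (i \in S :|: Q) && ((i \in X j) != (i \in X0)).
    rewrite !inE negb_and /f => jB; case: pickP => [i iP|noi]; first by exists i.
    exfalso; case/orP: jB => [/subsetPn[i iS iX]|].
      have := noi i; rewrite !inE iS /= (negPf iX).
      by rewrite (subsetP SX0 _ iS).
    rewrite -setI_eq0 => /set0Pn[i /setIP[iQ iX]].
    by have := noi i; rewrite !inE iQ iX orbT /= (disjointFr QX0 iQ).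
  have finj : {in ~: B &, injective f}.
    move=> j k /fP[i fj /andP[_ ij]] /fP[i' fk /andP[_ ik]]; rewrite fj fk => -[ii'].
    by apply: (Xdisj i) => //; rewrite ii'.
  rewrite -(card_in_imset finj).
  apply: leq_trans (_ : #|[set Some i | i in S :|: Q]| <= _)%N.
    apply/subset_leq_card/subsetP => o /imsetP[j /fP[i fj /andP[iSQ _]] ->].
    by rewrite fj; apply: imset_f.
  by rewrite card_imset; [exact: leq_card_setU | exact: Some_inj].
have -> : \sum_(j | (S \subset X j) && [disjoint Q & X j]) w * slack ab (X j)
    = w * (#|B|%:R * slack ab X0 - \sum_(j in B) (slack ab X0 - slack ab (X j))).
  rewrite sumrB sumr_const mulr_natl opprB addrC subrK mulr_sumr.
  by apply: eq_bigl => j; rewrite inE.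
have JE : #|J|%:R = #|B|%:R + #|~: B|%:R :> R by rewrite -natrD cardsC.
have {}hB : #|~: B|%:R <= t%:R :> R by rewrite ler_nat.
have tE : t%:R * w = 1 - 2 * w by have := w2; rewrite -[t.+2]addn2 natrD mulrDl; lra.
(* Write [z] for [slack ab X0] and [x] for the sum of the differences over [B]. The total is
   [z - #|~: B| * w * z - w * x], and [t * w = 1 - 2 * w] makes it nonnegative, since [#|~: B| <= t]
   and [x <= 2 * z]. *)
have : w * \sum_(j in B) (slack ab X0 - slack ab (X j)) <= w * (2 * slack ab X0).
  by rewrite ler_pM2l.
have : #|~: B|%:R * w * slack ab X0 <= t%:R * w * slack ab X0.
  by rewrite ler_wpM2r // ler_pM2r.
rewrite JE tE; set x := \sum_(j in B) _ => H1 H2.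
by move: (#|B|%:R : R) (#|~: B|%:R : R) (slack ab X0) x H1 H2 => b h z x; nra.
Qed.

End SignedCombination.

(** * The tightened linear program attains its minimum *)

Section Attained.
Variables (R : realType) (I : finType).

(** Entries at sets of more than [t.+1] elements are free. Setting them to zero allows the minimum
    to be sought in a compact cube. *)
Lemma sherali_adams_trunc (t : nat) (sys : seq (lin_ineq R I)) (y z : {set I} -> R) :
  (forall S : {set I}, (#|S| <= t.+1)%N -> y S = z S) ->
  sherali_adams t sys y -> sherali_adams t sys z.
Proof.
move=> yz [y0 yP]; split; first by rewrite -yz ?cards0.
move=> ab abs S Q dSQ SQt; move: (yP ab abs S Q dSQ SQt).
have cST T : T \in powerset Q -> (#|S :|: T| <= t)%N.
  rewrite powersetE => /subset_leq_card TQ; apply: leq_trans SQt.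
  by apply: leq_trans (leq_card_setU _ _) _; rewrite leq_add2l.
congr (_ * _ <= _); last apply: eq_bigr => i _; last congr (_ * _);
  apply: eq_bigr => T /cST sT; rewrite yz //; first exact: leqW.
apply: leq_trans (leq_card_setU _ _) _.
by rewrite cards1 addn1 ltnS.
Qed.

(** With [Q] empty, the bounds on coordinate [i] conditioned on [S :\ i] give
    [0 <= y S <= y (S :\ i)]; removing elements one by one ends at [y set0 = 1]. *)
Lemma sherali_adams_box (t : nat) (sys : seq (lin_ineq R I)) (y : {set I} -> R) :
  (forall i, ineq_ge (indic R [set i]) 0 \in sys) ->
  (forall i, ineq_le (indic R [set i]) 1 \in sys) ->
  sherali_adams t sys y -> forall S : {set I}, (#|S| <= t.+1)%N -> 0 <= y S <= 1.
Proof.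
move=> sys0 sys1 [y0 yP] S.
elim: {S}#|S| {-2}S (erefl #|S|) => [|n IH] S cS.
  by move=> _; rewrite (cards0_eq cS) y0 ler01 lexx.
have [i iS] : exists i, i \in S by apply/set0Pn; rewrite -card_gt0 cS.
have := cardsD1 i S; rewrite iS cS add1n => -[cS'] nt.
have /andP[_ y1] : 0 <= y (S :\ i) <= 1 by apply: IH; rewrite -?cS' // ltnW.
have dis : [disjoint S :\ i & set0] by rewrite disjoint_sym disjoints_subset sub0set.
have c0 : (#|S :\ i| + #|(set0 : {set I})| <= t)%N by rewrite -cS' cards0 addn0.
have E (F : {set I} -> R) :
    \sum_(T in powerset set0) (-1) ^+ #|T| * F T = F set0.
  by rewrite powerset0 big_set1 cards0 expr0 mul1r.
have indicE (G : I -> R) : \sum_j indic R [set i] j * G j = G i.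
  rewrite (bigD1 i) //= big1 => [|j ji].
    by rewrite ffunE inE eqxx mul1r addr0.
  by rewrite ffunE inE (negPf ji) mul0r.
have indicNE (G : I -> R) : \sum_j (- indic R [set i]) j * G j = - G i.
  by rewrite -[in RHS]indicE -sumrN; apply: eq_bigr => j _; rewrite !ffunE mulNr.
have := yP _ (sys0 i) _ _ dis c0; have := yP _ (sys1 i) _ _ dis c0.
rewrite /= indicE indicNE !E !setU0 setUC setD1K // mul0r mulN1r lerN2.
by move=> H1 H2; rewrite H2 (le_trans H1).
Qed.

Lemma continuous_lincomb (T : topologicalType) (J : finType) (P : pred J)
    (a : J -> R) (f : J -> T -> R) :
  (forall j, continuous (f j)) ->
  continuous (fun v => \sum_(j | P j) a j * f j v).
Proof.
move=> fc; apply: continuous_big; first exact: add_continuous.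
move=> j _ v; apply: continuousM; first exact: cst_continuous.
exact: fc.
Qed.

Lemma closed_sherali_adams (T : topologicalType) (t : nat)
    (sys : seq (lin_ineq R I)) (f : {set I} -> T -> R) :
  (forall S, continuous (f S)) ->
  topology_structure.closed [set v | sherali_adams t sys (f^~ v)]%classic.
Proof.
move=> fc.
pose D (p : lin_ineq R I * {set I} * {set I}) := [/\ p.1.1 \in sys,
  [disjoint p.1.2 & p.2] & (#|p.1.2| + #|p.2| <= t)%N].
pose lft (p : lin_ineq R I * {set I} * {set I}) v : R :=
  \sum_i p.1.1.1 i *
    \sum_(U in powerset p.2) (-1) ^+ #|U| * f (p.1.2 :|: U :|: [set i]) v.
pose rgt (p : lin_ineq R I * {set I} * {set I}) v : R :=
  \sum_(U in powerset p.2) (-1) ^+ #|U| * f (p.1.2 :|: U) v.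
have -> : [set v | sherali_adams t sys (f^~ v)]%classic =
   (f finset.set0 @^-1` [set x | x = 1 :> R] `&`
   \bigcap_(p in D) ((fun v => lft p v - p.1.1.2 * rgt p v) @^-1`
                        [set x | 0 <= x :> R]))%classic.
  apply/seteqP; split => v [v0 vP]; split => //.
    by case=> [[ab S] Q] [/= abs dSQ SQt]; rewrite /= subr_ge0; exact: vP.
  move=> ab abs S Q dSQ SQt; rewrite -subr_ge0.
  exact: (vP (ab, S, Q)).
apply: closedI.
  apply: preimage_closed; first by move=> v _; exact: fc.
  exact: closed_eq.
apply: closed_bigI => p _; apply: preimage_closed; last exact: closed_ge.
move=> v _; apply: continuousB.
  by apply: continuous_lincomb => i; exact: continuous_lincomb.
apply: continuousM; first exact: cst_continuous.
exact: continuous_lincomb.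
Qed.

(** Extreme value theorem: after truncation, the feasible vectors form a nonempty closed subset of a
    cube. *)
Lemma sherali_adams_min (t : nat) (sys : seq (lin_ineq R I)) (k : I -> R) :
  (forall i, ineq_ge (indic R [set i]) 0 \in sys) ->
  (forall i, ineq_le (indic R [set i]) 1 \in sys) ->
  (exists y, sherali_adams t sys y) ->
  exists m, is_minimum (fun a => exists2 y, sherali_adams t sys y
    & a = \sum_i k i * y [set i]) m.
Proof.
move=> sys0 sys1 [y0 y0P].
pose n := #|{: {set I}}|.
pose fam (v : 'rV[R]_n) (S : {set I}) : R := v ord0 (enum_rank S).
pose box := [set v : 'rV[R]_n | forall i, `[0 : R, 1]%classic (v ord0 i)]%classic.
pose A := (box `&` [set v | sherali_adams t sys (fam v)])%classic.
pose vec (y : {set I} -> R) : 'rV[R]_n :=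
  \row_i (if (#|(enum_val i : {set I})| <= t.+1)%N then y (enum_val i) else 0).
have vecE y (S : {set I}) : (#|S| <= t.+1)%N -> fam (vec y) S = y S.
  by move=> St; rewrite /fam /vec mxE enum_rankK St.
have vecA y : sherali_adams t sys y -> A (vec y).
  move=> yP; split => [i|] /=.
    rewrite mxE in_itv /=; case: ifP => [|_]; last by rewrite lexx ler01.
    exact: (sherali_adams_box sys0 sys1 yP).
  by apply: sherali_adams_trunc yP => S St; rewrite vecE.
have cA : compact A.
  apply: compact_closedI.
    by apply: (rV_compact (A := fun=> `[0 : R, 1]%classic)) => i; exact: segment_compact.
  by apply: (closed_sherali_adams (f := fun S v => fam v S)) => S; exact: coord_continuous.
have cf : continuous (fun v : 'rV[R]_n => \sum_i k i * fam v [set i]).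
  by apply: continuous_lincomb => i; exact: coord_continuous.
have A0 : (A !=set0)%classic by exists (vec y0); exact: vecA.
have [v vA vmin] := compact_EVT_min A0 cA (continuous_subspaceT cf).
exists (\sum_i k i * fam v [set i]); split.
  by exists (fam v) => //; case/set_mem: vA.
move=> _ [y yP ->]; have := vmin _ (mem_set (vecA _ yP)).
congr (_ <= _); apply: eq_bigr => i _; rewrite vecE //.
by rewrite cards1.
Qed.
End Attained.

(** * Cycle covers given by permutations *)

Section PermutationTours.
Variables (R : realType) (V : finType).
Implicit Types (s : {perm V}) (U : {set V}) (v : V).

Definition perm_edges s : {set kedge V} :=
  [set e : kedge V | s (val e).1 == (val e).2].

(** For a permutation this means being a single cycle. In this form it yields the cut constraints of
    a tour and drives the lower bound on its cost. *)
Definition exits (f : V -> V) : Prop :=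
  forall U, U != set0 -> U != [set: V] -> exists2 v, v \in U & f v \notin U.

Lemma sum_perm_edges s (H : V * V -> R) : (forall v, s v != v) ->
  \sum_(e in perm_edges s) H (val e) = \sum_v H (v, s v).
Proof.
move=> sv.
have svP v : (v, s v).1 != (v, s v).2 by rewrite /= eq_sym.
rewrite (reindex (fun v => exist _ (v, s v) (svP v) : kedge V)) /=.
  by apply: eq_bigl => v; rewrite inE /= eqxx.
exists (fun e : kedge V => (val e).1) => [//|e].
by rewrite inE => /eqP se; apply: val_inj; rewrite /= se -surjective_pairing.
Qed.

Lemma sum_indic (F X : {set kedge V}) :
  \sum_(e in X) indic R F e = \sum_(e in X) (e \in F)%:R.
Proof. by apply: eq_bigr => e _; rewrite ffunE. Qed.

Lemma sum_delta_out s U : (forall v, s v != v) ->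
  \sum_(e in perm_edges s) indic R (delta_out U) e
    = \sum_v ((v \in U) && (s v \notin U))%:R.
Proof.
move=> sv; rewrite sum_indic.
rewrite -(sum_perm_edges (fun e => ((e.1 \in U) && (e.2 \notin U))%:R) sv).
by apply: eq_bigr => e _; rewrite inE.
Qed.

Lemma delta_inE U : delta_in U = delta_out (~: U) :> {set kedge V}.
Proof. by apply/setP => e; rewrite !inE negbK. Qed.

Lemma sum_delta_out1 s v : (forall v, s v != v) ->
  \sum_(e in perm_edges s) indic R (delta_out [set v]) e = 1.
Proof.
move=> sv; rewrite sum_delta_out // (bigD1 v) //= big1 => [|u uv].
  by rewrite !inE eqxx sv addr0.
by rewrite inE (negPf uv).
Qed.

Lemma sum_delta_in1 s v : (forall v, s v != v) ->
  \sum_(e in perm_edges s) indic R (delta_in [set v]) e = 1.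
Proof.
move=> sv; rewrite delta_inE sum_delta_out // (bigD1 ((s^-1)%g v)) //= big1.
  by rewrite !inE permKV negbK eqxx -[X in _ == X](permKV s) eq_sym sv addr0.
move=> u uv; rewrite !inE negbK.
suff /negPf -> : s u != v by rewrite andbF.
by apply: contraNneq uv => <-; rewrite permK.
Qed.

Lemma sum_edge s (e : kedge V) : (forall v, s v != v) ->
  \sum_(f in perm_edges s) indic R [set e] f = (s (val e).1 == (val e).2)%:R.
Proof.
move=> sv; rewrite sum_indic.
have [es|] := boolP (e \in perm_edges s).
  rewrite (bigD1 e) //= big1 => [|f /andP[_ /negPf fe]]; last by rewrite inE fe.
  by move: es; rewrite !inE eqxx addr0 => ->.
move=> es; rewrite big1 => [|f fs]; first by move: es; rewrite inE => /negPf ->.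
by rewrite inE; case: eqP => // fe; rewrite fe (negPf es) in fs.
Qed.

(* At most one [j] changes the successor of [v], so each term [h v (s0 v)] is lost
   at most once. *)
Lemma sum_switch (J : finType) (s0 : {perm V}) (s : J -> {perm V})
    (h : V -> V -> R) (B : {set J}) :
  (forall v j k, s j v != s0 v -> s k v != s0 v -> j = k) ->
  (forall u v, 0 <= h u v) ->
  \sum_(j in B) (\sum_v h v (s0 v) - \sum_v h v (s j v)) <= \sum_v h v (s0 v).
Proof.
move=> sdisj h0.
under eq_bigr => j _ do rewrite -sumrB.
rewrite exchange_big /=; apply: ler_sum => v _.
have [/existsP[j /andP[jB sj]]|] := boolP [exists j, (j \in B) && (s j v != s0 v)].
  rewrite (bigD1 j) //= big1 => [|k /andP[_ kj]]; first by rewrite addr0 gerBl.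
  have [->|sk] := eqVneq (s k v) (s0 v); first by rewrite subrr.
  by rewrite (sdisj v k j sk sj) eqxx in kj.
rewrite negb_exists => /forallP noj; rewrite big1 // => j jB.
by have := noj j; rewrite jB /= negbK => /eqP ->; rewrite subrr.
Qed.

(** Since [delta_in U] is [delta_out (~: U)], the two families of cut constraints reduce to one. *)
Lemma dfj_systemP (P : lin_ineq R (kedge V) -> Prop) :
  (forall U, U != set0 -> U != [set: V] -> P (ineq_ge (indic R (delta_out U)) 1)) ->
  (forall v, P (ineq_ge (indic R (delta_in [set v])) 1)) ->
  (forall v, P (ineq_le (indic R (delta_in [set v])) 1)) ->
  (forall v, P (ineq_ge (indic R (delta_out [set v])) 1)) ->
  (forall v, P (ineq_le (indic R (delta_out [set v])) 1)) ->
  (forall e, P (ineq_ge (indic R [set e]) 0)) ->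
  (forall e, P (ineq_le (indic R [set e]) 1)) ->
  forall ab, ab \in dfj_system R V -> P ab.
Proof.
move=> Pout Pin1 Pin2 Pout1 Pout2 Pe1 Pe2 ab; rewrite /dfj_system !mem_cat.
case/or4P=> [||| /or4P[||| /orP[]]] /mapP[x]; rewrite ?mem_enum ?inE.
- case/andP=> x0 xT ->; rewrite delta_inE; apply: Pout.
    by rewrite -setCT (inj_eq (@setC_inj _)).
  by rewrite -setC0 (inj_eq (@setC_inj _)).
- by case/andP=> x0 xT ->; exact: Pout.
all: by move=> _ ->.
Qed.

(** The tours satisfy every constraint and the degree equations are tight at [s0], so among the
    hypotheses of [sherali_adams_star] only those on cuts and edge bounds at [s0] call for
    [sum_switch]. *)
Lemma sherali_adams_dfj_tours (J : finType) (t : nat) (s0 : {perm V})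
    (s : J -> {perm V}) :
  (t.+2 <= #|J|)%N ->
  (forall v, s0 v != v) -> (forall j v, s j v != v) ->
  (forall j, exits (s j)) ->
  (forall v j k, s j v != s0 v -> s k v != s0 v -> j = k) ->
  sherali_adams t (dfj_system R V) (fun S =>
     t.+2%:R^-1 * \sum_j (S \subset perm_edges (s j))%:R
     + (1 - #|J|%:R / t.+2%:R) * (S \subset perm_edges s0)%:R).
Proof.
move=> tJ s0v sv sexit sdisj.
pose cut U (f : V -> V) : R := \sum_v ((v \in U) && (f v \notin U))%:R.
have cut_ge0 U f : 0 <= cut U f by apply: sumr_ge0.
have cutN U (f : V -> V) : cut U f = #|[set v | (v \in U) && (f v \notin U)]|%:R.
  by rewrite -sum1_card natr_sum big_mkcond; apply: eq_bigr => v _; rewrite inE; case: ifP.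
have slackN a b X : slack (ineq_le a b) X = b - \sum_(e in X) a e :> R.
  rewrite /slack /= addrC opprK -sumrN; congr (_ + _); apply: eq_bigr => e _.
  by rewrite ffunE.
have slackE a b X : slack (ineq_ge a b) X = \sum_(e in X) a e - b :> R by [].
apply: sherali_adams_star => //.
- move=> e j k; rewrite !inE => ej ek; apply: (sdisj (val e).1).
    by apply: contraNneq ej => ->.
  by apply: contraNneq ek => ->.
- apply: dfj_systemP => [U U0 UT j|v j|v j|v j|v j|e j|e j]; rewrite ?slackN ?slackE /=.
  + rewrite sum_delta_out // -/(cut U (s j)) cutN subr_ge0 ler1n card_gt0.
    have [v vU sU] := sexit j U U0 UT.
    by apply/set0Pn; exists v; rewrite inE vU.
  + by rewrite sum_delta_in1 // subrr.
  + by rewrite sum_delta_in1 // subrr.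
  + by rewrite sum_delta_out1 // subrr.
  + by rewrite sum_delta_out1 // subrr.
  + by rewrite sum_edge // subr0.
  + by rewrite sum_edge // subr_ge0 lern1 leq_b1.
apply: dfj_systemP => [U U0 UT|v|v|v|v|e|e]; rewrite ?slackN ?slackE /=.
- rewrite sum_delta_out // -/(cut U s0) cutN.
  (* If [s0] leaves [U] along [d] edges, the slack is [d - 1], while the total loss is at most [d],
     hence at most [2 * (d - 1)] once [d >= 2]. *)
  set d := #|_|; have [d1|d2] := leqP d 1.
    by left; rewrite subr_le0 lern1.
  right=> B; apply: le_trans (_ : d%:R <= _).
    have := sum_switch (h := fun u v => ((u \in U) && (v \notin U))%:R) B sdisj (fun _ _ => ler0n _ _).
    rewrite -/(cut U s0) cutN -/d; apply: le_trans.
    rewrite le_eqVlt; apply/orP; left; apply/eqP; apply: eq_bigr => j _.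
    by rewrite slackE sum_delta_out //; ring.
  have : 2 <= d%:R :> R by rewrite ler_nat.
  lra.
- by left; rewrite sum_delta_in1 // subrr.
- by left; rewrite sum_delta_in1 // subrr.
- by left; rewrite sum_delta_out1 // subrr.
- by left; rewrite sum_delta_out1 // subrr.
- right=> B; rewrite sum_edge // subr0.
  have h1 (f : {perm V}) : \sum_v ((v == (val e).1) && (f v == (val e).2))%:R
      = (f (val e).1 == (val e).2)%:R :> R.
    rewrite (bigD1 (val e).1) //= eqxx big1 ?addr0 // => v /negPf -> //.
  have := sum_switch (h := fun u v => ((u == (val e).1) && (v == (val e).2))%:R) B sdisj (fun _ _ => ler0n _ _).
  rewrite h1 => H.
  apply: (@le_trans _ _ (s0 (val e).1 == (val e).2)%:R).
    apply: le_trans H; rewrite le_eqVlt; apply/orP; left; apply/eqP.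
    by apply: eq_bigr => j _; rewrite slackE sum_edge // h1 subr0.
  have : 0 <= (s0 (val e).1 == (val e).2)%:R :> R by [].
  lra.
right=> B; rewrite sum_edge //.
(* The slack of the upper bound on [e] tells whether the tail of [e] has a successor other than the
   head, which is again a sum of the form handled by [sum_switch]. *)
have h1 (f : {perm V}) : \sum_v ((v == (val e).1) && (f v != (val e).2))%:R
    = 1 - (f (val e).1 == (val e).2)%:R :> R.
  rewrite (bigD1 (val e).1) //= eqxx big1 ?addr0 => [|v /negPf -> //].
  by case: eqP => _; rewrite ?subrr ?subr0.
have := sum_switch (h := fun u v => ((u == (val e).1) && (v != (val e).2))%:R) B sdisj (fun _ _ => ler0n _ _).
rewrite h1 => H.
apply: (@le_trans _ _ (1 - (s0 (val e).1 == (val e).2)%:R)).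
  apply: le_trans H; rewrite le_eqVlt; apply/orP; left; apply/eqP.
  by apply: eq_bigr => j _; rewrite slackN sum_edge // h1.
have : (s0 (val e).1 == (val e).2)%:R <= 1 :> R by rewrite lern1 leq_b1.
lra.
Qed.

End PermutationTours.

Lemma exits_porbits1 (V : finType) (s : {perm V}) : #|porbits s| = 1%N -> exits s.
Proof.
move=> /eqP/cards1P[O porbE] U /set0Pn[x xU] UT.
have porbO v : porbit s v = O by apply/set1P; rewrite -porbE imset_f.
have [v /andP[vU svU]|noexit] := pickP [pred v | (v \in U) && (s v \notin U)].
  by exists v.
case/negP: UT; rewrite eqEsubset subsetT; apply/subsetP => y _.
have : y \in porbit s x by rewrite porbO -(porbO y) porbit_id.
case/porbitP=> k ->; elim: k => [|k IH]; first by rewrite expg0 perm1.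
rewrite expgSr permM; have := noexit ((s ^+ k)%g x).
by rewrite /= IH /= => /negbFE.
Qed.

(** * Hamiltonian dicycles and metric completion *)

Section Tours.
Variables (R : realType) (V : finType).
Implicit Types (c : V -> V -> R) (p : seq V).

Lemma metric_completion_triangle c :
  (forall u v w, c u w <= c u v + c v w) ->
  metric_completion [rel v w | v != w] c c.
Proof.
move=> tri v w vw; split.
  exists [:: w]; first by split; rewrite //= ?vw // inE vw.
  by rewrite /dipath_cost /= big_seq1.
move=> _ [p [_ _ pw] ->]; rewrite /dipath_cost.
case: p pw => [|x p] /= pw; first by rewrite pw eqxx in vw.
rewrite -pw big_cons => {vw pw}; elim: p v x => [|z p IH] v x /=.
  by rewrite big_nil addr0.
by rewrite big_cons addrA; apply: le_trans (IH v z) _; rewrite lerD2r.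
Qed.

Lemma hamiltonian_min c : (1 < #|V|)%N -> exists m, is_minimum
  (fun a => exists2 p, hamiltonian_dicycle p & a = dicycle_cost c p) m.
Proof.
move=> V1.
pose P (q : #|V|.-tuple V) := ucycleb [rel v w | v != w] q.
(* Any enumeration of the vertices is a Hamiltonian dicycle; [V1] ensures that its closing edge is
   not a loop. *)
have ham0 : P [tuple of enum V].
  rewrite /P /ucycleb enum_uniq andbT /=.
  have := enum_uniq V; have : (1 < size (enum V))%N by rewrite -cardE.
  case: (enum V) => [|x s] //= s0 /andP[xs us]; rewrite rcons_path.
  apply/andP; split; last first.
    by apply: contraNneq xs => <-; case: s s0 us => //= y s _ _; exact: mem_last.
  elim: s x xs us {s0} => //= y s IH x.
  by rewrite inE negb_or => /andP[-> _] /andP[ys us]; exact: IH.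
have [q qP qmin] := arg_minP (fun q : #|V|.-tuple V => dicycle_cost c q) ham0.
exists (dicycle_cost c q); split.
  by exists q => //; split; rewrite ?size_tuple.
move=> _ [p [pc ps] ->].
have pP : P (tcast ps (in_tuple p)) by rewrite /P val_tcast.
by have := qmin _ pP; rewrite val_tcast.
Qed.

(** The lower bound on the cost is stated for successor functions; this turns a dicycle into one. *)
Lemma hamiltonian_next p : hamiltonian_dicycle p ->
  [/\ injective (next p), exits (next p) &
      forall c, dicycle_cost c p = \sum_v c v (next p v)].
Proof.
move=> [/andP[_ up] sp].
have pT v : v \in p.
  have sub : {subset p <= enum V} by move=> u _; rewrite mem_enum.
  by rewrite (uniq_min_size up sub _).2 ?mem_enum // sp cardE.
split.
- exact: can_inj (prev_next up).
- move=> U /set0Pn[x xU] UT.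
  have [v /andP[vU svU]|noexit] := pickP [pred v | (v \in U) && (next p v \notin U)].
    by exists v.
  case/negP: UT; rewrite eqEsubset subsetT; apply/subsetP => y _.
  have xy : fconnect (next p) x y by rewrite (fconnect_cycle (cycle_next up)).
  rewrite -(iter_findex xy); elim: (findex _ _ _) => //= k IH.
  have := noexit (iter k (next p) x).
  by rewrite /= IH /= => /negbFE.
- move=> c; rewrite /dicycle_cost big_uniq //=.
  by apply: eq_bigl => v; rewrite pT.
Qed.

End Tours.

(** The case of empty [S] and [Q], which serves to show that the LP value is positive. *)
Lemma sherali_adams_relaxes (R : realType) (I : finType) (t : nat) sys
    (y : {set I} -> R) ab :
  sherali_adams t sys y -> ab \in sys -> ab.2 <= \sum_i ab.1 i * y [set i].
Proof.
move=> [y0 yP] abs.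
have := yP ab abs set0 set0; rewrite disjoints_subset sub0set cards0.
move=> /(_ isT isT); rewrite powerset0 big_set1 cards0 expr0 mul1r setU0 y0 mulr1.
congr (_ <= _); apply: eq_bigr => i _.
by rewrite big_set1 cards0 expr0 mul1r !set0U.
Qed.

(** * The instance *)

Section Instance.
Variable m : nat.

(* [(i, s)] with [i <= m] is a copy of the point [flip s i], and [(m.+1, s)] is
   the request from [flip s m] to [flip s 0]; a tour enters [v] at [inpos v] and
   leaves it at [outpos v]. *)
Definition vertex : finType := ('I_m.+2 * bool)%type.

Definition flip (s : bool) (x : nat) : nat := if s then x else (m - x)%N.
Definition inpos (v : vertex) : nat := flip v.2 (minn v.1 m).
Definition outpos (v : vertex) : nat := flip v.2 (if (v.1 <= m)%N then v.1 : nat else 0%N).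
Definition dst (x y : nat) : nat := ((x - y) + (y - x))%N.
(** The way from where [u] is left to where [v] is entered, plus the service of [v], which is
    charged to the edge entering it. *)
Definition cost (u v : vertex) : nat :=
  (dst (outpos u) (inpos v) + dst (inpos v) (outpos v))%N.

Definition rotate (v : vertex) : vertex := (ordS v.1, v.2).

Lemma rotate_inj : injective rotate.
Proof. by case=> i s [j r] [Ei ->]; congr (_, _); apply: ordS_inj; exact: val_inj. Qed.

Definition two_cycles : {perm vertex} := perm rotate_inj.

(** The tails of the edges that cross the gap between [j] and [j.+1]: [swap_left j] lies at [j] on
    the cycle moving right, [swap_right j] at [j.+1] on the cycle moving left. *)
Definition swap_left (j : 'I_m) : vertex := (inord j, true).
Definition swap_right (j : 'I_m) : vertex := (inord (m - j.+1), false).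
Definition tour (j : 'I_m) : {perm vertex} :=
  (tperm (swap_left j) (swap_right j) * two_cycles)%g.

Lemma inpos_le v : (inpos v <= m)%N.
Proof. case: v => [[i im] [|]]; rewrite /inpos /flip /=; lia. Qed.

Lemma outpos_le v : (outpos v <= m)%N.
Proof. case: v => [[i im] [|]]; rewrite /outpos /flip /=; case: ifP; lia. Qed.

(** Requests are entered and left at the ends of the line, so an interior position belongs to a copy
    of a point. *)
Lemma outpos_interior v : (0 < inpos v < m)%N -> outpos v = inpos v.
Proof.
rewrite /inpos /outpos; case: v => [[i im] [|]] /=; rewrite /flip /=; case: ifP; lia.
Qed.

Lemma sum_vertex (F : vertex -> nat) :
  (\sum_v F v = \sum_(i < m.+2) F (i, true) + \sum_(i < m.+2) F (i, false))%N.
Proof.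
transitivity (\sum_i \sum_s F (i, s))%N.
  by rewrite pair_bigA; apply: eq_bigr => -[i s].
by rewrite -big_split; apply: eq_bigr => i _; rewrite big_bool.
Qed.

Lemma sum_shift_cost : (\sum_v dst (inpos v) (outpos v) = 2 * m)%N.
Proof.
have shiftE s : (\sum_(i < m.+2) dst (inpos (i, s)) (outpos (i, s)) = m)%N.
  rewrite !big_ord_recr big1 /= => [|i _]; rewrite /dst /inpos /outpos /flip /=.
    rewrite leqnn ltnn; case: s; lia.
  have im := ltn_ord i; rewrite (ltnW im); case: s; lia.
by rewrite sum_vertex !shiftE mul2n addnn.
Qed.

(** A copy is left where it is entered, and the two requests exchange the ends [0] and [m]; so the
    entering and the leaving positions agree as multisets. *)
Lemma sum_pos (phi : nat -> nat) :
  (\sum_v phi (outpos v) = \sum_v phi (inpos v))%N.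
Proof.
rewrite !sum_vertex -!big_split /= !big_ord_recr /= -!addnA; congr (_ + _)%N.
  apply: eq_bigr => i _; have im := ltn_ord i.
  by rewrite /inpos /outpos /flip /= (ltnW im) (minn_idPl (ltnW im)).
rewrite /inpos /outpos /flip /= leqnn ltnn minnn (minn_idPr (leqnSn m)) subnn subn0.
lia.
Qed.

Lemma cost_triangle u v w : (cost u w <= cost u v + cost v w)%N.
Proof. rewrite /cost /dst; lia. Qed.

(** * The two cycles and the tours merging them *)

Lemma cost_two_cycles v : cost v (two_cycles v) =
  if (v.1 < m)%N then 1%N else if v.1 == m :> nat then m else 0%N.
Proof.
rewrite permE /cost /dst /inpos /outpos /flip /rotate.
case: v => [[i im] s] /=.
have -> : (i.+1 %% m.+2 = if i == m.+1 then 0 else i.+1)%N.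
  case: eqP => [->|im']; first by rewrite modnn.
  by rewrite modn_small //; lia.
case: s; do !case: ifP; rewrite ?leq0n; lia.
Qed.

Lemma sum_cost_two_cycles : (\sum_v cost v (two_cycles v) = 4 * m)%N.
Proof.
under eq_bigr => v _ do rewrite cost_two_cycles.
have costE : (\sum_(i < m.+2) (if i < m then 1 else if i == m :> nat then m else 0) = 2 * m)%N.
  rewrite !big_ord_recr /= ltnn eqxx ltnNge leqnSn /= gtn_eqF //.
  under eq_bigr => i _ do rewrite ltn_ord.
  by rewrite sum1_card card_ord; lia.
by rewrite sum_vertex /= !costE; lia.
Qed.

Lemma two_cycles_neq v : two_cycles v != v.
Proof.
rewrite permE; case: v => [[i im] s]; apply: contraTneq isT => -[].
case: (eqVneq i m.+1) => [->|im']; first by rewrite modnn.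
by rewrite modn_small; lia.
Qed.

Lemma tour_left j : tour j (swap_left j) = two_cycles (swap_right j).
Proof. by rewrite permM tpermL. Qed.

Lemma tour_right j : tour j (swap_right j) = two_cycles (swap_left j).
Proof. by rewrite permM tpermR. Qed.

Lemma tourD j v : v != swap_left j -> v != swap_right j -> tour j v = two_cycles v.
Proof. by move=> vl vr; rewrite permM tpermD // eq_sym. Qed.

Lemma swap_left1 j : (swap_left j).1 = j :> nat.
Proof. by rewrite /= inordK //; have := ltn_ord j; lia. Qed.

Lemma swap_right1 j : (swap_right j).1 = (m - j.+1)%N :> nat.
Proof. by rewrite /= inordK //; have := ltn_ord j; lia. Qed.

(** The second component of [v] tells which of the two tails it is, and the first component then
    determines the gap. *)
Lemma tour_disjoint v (j k : 'I_m) :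
  tour j v != two_cycles v -> tour k v != two_cycles v -> j = k.
Proof.
have tourP i : tour i v != two_cycles v -> v = if v.2 then swap_left i else swap_right i.
  have [->//|vl] := eqVneq v (swap_left i); have [->//|vr] := eqVneq v (swap_right i).
  by rewrite tourD ?eqxx.
move=> /tourP Ej /tourP Ek; apply: val_inj => /=.
have := swap_left1 j; have := swap_left1 k; have := swap_right1 j; have := swap_right1 k.
have := ltn_ord j; have := ltn_ord k.
have : (if v.2 then swap_left j else swap_right j)
     = (if v.2 then swap_left k else swap_right k) by rewrite -Ej -Ek.
by move=> /(congr1 (fun u : vertex => u.1 : nat)); case: v.2; lia.
Qed.

Lemma porbit_two_cycles v : porbit two_cycles v = [set u | u.2 == v.2].
Proof.
apply/setP => u; rewrite inE; apply/porbitP/eqP => [[k ->]|].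
  elim: k => [|k IH]; first by rewrite expg0 perm1.
  by rewrite expgSr permM permE /= IH.
case: u v => [[i im] s] [[k km] r] /= ->.
(* Congruent to [i - k] modulo [m.+2], also when [i < k]. *)
exists (i + (m.+2 - k))%N.
have iterE n : ((two_cycles ^+ n)%g (Ordinal km, r)).1 = ((k + n) %% m.+2)%N :> nat
   /\ ((two_cycles ^+ n)%g (Ordinal km, r)).2 = r.
  elim: n => [|n [IH1 IH2]]; first by rewrite expg0 perm1 addn0 modn_small.
  rewrite expgSr permM permE /= IH1 IH2; split => //.
  by rewrite addnS -addn1 modnDml addn1.
have [E1 E2] := iterE (i + (m.+2 - k))%N.
apply/eqP; rewrite [X in _ == X]surjective_pairing xpair_eqE E2 eqxx andbT.
apply/eqP/val_inj; rewrite /= E1.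
have -> : (k + (i + (m.+2 - k)) = i + m.+2)%N by lia.
by rewrite modnDr modn_small.
Qed.

Lemma exits_tour j : exits (tour j).
Proof.
apply: exits_porbits1.
(* Multiplying by a transposition of elements of distinct orbits merges these orbits, here the only
   two. *)
have := porbits_mul_tperm two_cycles (swap_left j) (swap_right j).
rewrite /= -/(tour j) porbit_two_cycles inE /=.
have -> : #|porbits two_cycles| = 2%N.
  have -> : porbits two_cycles = [set [set u : vertex | u.2 == b] | b : bool].
    apply/setP => O; apply/imsetP/imsetP => [[v _ ->]|[b _ ->]].
      by exists v.2 => //; rewrite porbit_two_cycles.
    by exists (ord0, b) => //; rewrite porbit_two_cycles.
  rewrite card_imset ?card_bool // => b b' /setP/(_ (ord0, b)).
  by rewrite !inE eqxx => /esym/eqP.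
have -> : swap_left j != swap_right j by rewrite /swap_left /swap_right xpair_eqE andbF.
by rewrite /= addn1 => -[]; lia.
Qed.

Lemma tour_neq j v : tour j v != v.
Proof.
have [->|vl] := eqVneq v (swap_left j).
  by rewrite tour_left permE /rotate /= xpair_eqE andbF.
have [->|vr] := eqVneq v (swap_right j).
  by rewrite tour_right permE /rotate /= xpair_eqE andbF.
by rewrite tourD // two_cycles_neq.
Qed.

(** The two unit steps across the gap become free steps, each between the two copies of one end of
    the gap. *)
Lemma sum_cost_tour j : (\sum_v cost v (tour j v) + 2 = 4 * m)%N.
Proof.
have lr : swap_right j != swap_left j by rewrite /swap_left /swap_right xpair_eqE andbF.
rewrite -sum_cost_two_cycles (bigD1 (swap_left j)) // (bigD1 (swap_right j)) //=.
rewrite [in RHS](bigD1 (swap_left j)) // [in RHS](bigD1 (swap_right j)) //=.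
rewrite [X in (_ + (_ + X) + 2 = _)%N](eq_bigr (fun v => cost v (two_cycles v))); last first.
  by move=> v /andP[vl vr]; rewrite tourD.
rewrite !cost_two_cycles swap_left1 swap_right1 tour_left tour_right.
have jm := ltn_ord j.
have c0 : cost (swap_left j) (two_cycles (swap_right j)) = 0%N.
  rewrite /cost /dst /inpos /outpos /flip permE /=.
  have := swap_left1 j; have := swap_right1 j => /= -> ->.
  rewrite modn_small; last by lia.
  do !case: ifP; rewrite ?leq0n; lia.
have c1 : cost (swap_right j) (two_cycles (swap_left j)) = 0%N.
  rewrite /cost /dst /inpos /outpos /flip permE /=.
  have := swap_left1 j; have := swap_right1 j => /= -> ->.
  rewrite modn_small; last by lia.
  do !case: ifP; rewrite ?leq0n; lia.
rewrite c0 c1 jm; have -> : (m - j.+1 < m)%N by lia.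
by set S := (X in _ = (1 + (1 + X))%N); rewrite !add0n addn2 !add1n.
Qed.

(** * Lower bound on the cost of a Hamiltonian dicycle *)

Lemma sum_gaps (x y n : nat) : (\sum_(g < n) (x <= g < y) = minn y n - x)%N.
Proof.
elim: n => [|n IH]; first by rewrite big_ord0 minn0.
by rewrite big_ord_recr /= IH; lia.
Qed.

Lemma cost_lower_bound (f : vertex -> vertex) :
  injective f -> exits f -> (4 * m - 2 <= \sum_v cost v (f v))%N.
Proof.
move=> finj fexit.
(* Gap [g] lies between [g] and [g.+1]; [rgt] and [lft] count the moves across it in each
   direction. *)
pose rgt (g : 'I_m) := (\sum_v (outpos v <= g < inpos (f v)))%N.
pose lft (g : 'I_m) := (\sum_v (inpos (f v) <= g < outpos v))%N.
(* By [sum_pos], as many moves start to the right of a gap as end there. *)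
have balance g : rgt g = lft g.
  have := sum_pos (fun x => nat_of_bool (g < x)%N).
  rewrite [in RHS](reindex_inj finj) /= => E.
  apply/eqP; rewrite -(eqn_add2r (\sum_v (g < outpos v))%N) {2}E -!big_split /=.
  apply/eqP/eq_bigr => v _; lia.
have gapE : (\sum_v dst (outpos v) (inpos (f v)) = 2 * \sum_g rgt g)%N.
  rewrite mul2n -addnn {2}(eq_bigr lft) // /rgt /lft.
  rewrite exchange_big [X in (_ = _ + X)%N]exchange_big -big_split /=.
  apply: eq_bigr => v _; rewrite !sum_gaps /dst.
  by have := outpos_le v; have := inpos_le (f v); lia.
have uncrossed (g g' : 'I_m) : rgt g = 0%N -> rgt g' = 0%N -> ~~ (g < g')%N.
  move=> rg rg'; apply/negP => gg'; have g'm := ltn_ord g'.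
  have lg : lft g = 0%N by rewrite -balance.
  (* With no leftward move across [g] and no rightward move across [g'], the successor of a vertex
     of [U] is entered between these gaps. This position is interior, so the successor is also left
     there and [f] never leaves [U]. *)
  pose U := [set v | (g < outpos v <= g')%N].
  have [||v] := fexit U.
  - apply/set0Pn; exists (inord g.+1, true).
    by rewrite inE /outpos /flip /= inordK; [case: ifP|]; lia.
  - apply/negP => /eqP/setP/(_ (ord_max, true)).
    by rewrite !inE /outpos /flip /= ltnn ltn0.
  rewrite inE => vU; case/negP; rewrite inE.
  move/eqP: lg; rewrite sum_nat_eq0 => /forallP/(_ v) /= lv.
  move/eqP: rg'; rewrite sum_nat_eq0 => /forallP/(_ v) /= rv.
  have iU : (g < inpos (f v) <= g')%N by lia.
  by rewrite outpos_interior //; lia.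
have rgt_sum : (m - 1 <= \sum_g rgt g)%N.
  (* By [uncrossed], at most one gap is never crossed; each of the others contributes at least
     one. *)
  have [g /eqP rg|rgt_gt0] := pickP [pred g | rgt g == 0%N].
    rewrite (bigD1 g) //= rg add0n.
    apply: leq_trans (_ : \sum_(h | h != g) 1 <= _)%N.
      by rewrite sum1_card cardC1 card_ord subn1.
    apply: leq_sum => h hg; rewrite lt0n; apply: contraNneq hg => rh.
    by apply/eqP/val_inj => /=; have := uncrossed _ _ rg rh; have := uncrossed _ _ rh rg; lia.
  apply: leq_trans (_ : \sum_(h : 'I_m) 1 <= _)%N.
    by rewrite sum1_card card_ord leq_subr.
  by apply: leq_sum => h _; rewrite lt0n; have /= -> := rgt_gt0 h.
have shiftE : (\sum_v dst (inpos (f v)) (outpos (f v)) = 2 * m)%N.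
  by rewrite -sum_shift_cost [RHS](reindex_inj finj).
by rewrite big_split /= gapE shiftE; lia.
Qed.

End Instance.

(** * The integrality ratio of the instance *)

Lemma instance_integrality_ratio (R : realType) (t m : nat) : (t.+2 <= m)%N ->
  exists2 r : R, integrality_ratio t (fun u v : vertex m => (cost u v)%:R) r &
    (4 * m%:R - 2) / (4 * m%:R - 2 * m%:R / t.+2%:R) <= r.
Proof.
move=> tm; set c' := fun u v : vertex m => (cost u v)%:R : R.
have m_gt0 : (0 < m)%N by lia.
have sys0 e : ineq_ge (indic R [set e]) 0 \in dfj_system R (vertex m).
  rewrite /dfj_system !mem_cat; do 6!(apply/orP; right).
  by apply/orP; left; apply: map_f; rewrite mem_enum.
have sys1 e : ineq_le (indic R [set e]) 1 \in dfj_system R (vertex m).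
  rewrite /dfj_system !mem_cat; do 7!(apply/orP; right).
  by apply: map_f; rewrite mem_enum.
have cardV : #|vertex m| = (2 * m + 4)%N.
  by rewrite card_prod card_ord card_bool; lia.
have [opt optP] : exists opt, is_minimum (fun a => exists2 p,
    hamiltonian_dicycle p & a = dicycle_cost c' p) opt.
  by apply: hamiltonian_min; rewrite cardV; lia.
have opt_ge : 4 * m%:R - 2 <= opt.
  have [[p pham ->] _] := optP; have [pinj pexit ->] := hamiltonian_next R pham.
  have := cost_lower_bound pinj pexit; rewrite leq_subLR -(ler_nat R) natrD natrM natr_sum.
  by rewrite lerBlDl.
pose y (S : {set kedge (vertex m)}) : R :=
  t.+2%:R^-1 * \sum_j (S \subset perm_edges (@tour m j))%:R
     + (1 - #|'I_m|%:R / t.+2%:R) * (S \subset perm_edges (two_cycles m))%:R.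
have yP : sherali_adams t (dfj_system R (vertex m)) y.
  apply: (sherali_adams_dfj_tours R (s := @tour m)).
  - by rewrite card_ord.
  - exact: two_cycles_neq.
  - exact: tour_neq.
  - exact: exits_tour.
  - exact: tour_disjoint.
have permE' (s : {perm vertex m}) : (forall v, s v != v) ->
    \sum_(e : kedge (vertex m)) c' (val e).1 (val e).2 * ([set e] \subset perm_edges s)%:R
    = (\sum_v cost v (s v))%:R.
  move=> sv; rewrite natr_sum -(sum_perm_edges (fun e => c' e.1 e.2) sv).
  rewrite [RHS]big_mkcond; apply: eq_bigr => e _.
  by rewrite sub1set; case: (e \in _); rewrite ?mulr1 ?mulr0.
have ycost : sa_cost c' y = 4 * m%:R - 2 * m%:R / t.+2%:R.
  rewrite /sa_cost /y.
  rewrite (eq_bigr (fun e : kedge (vertex m) =>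
     t.+2%:R^-1 * (\sum_j c' (val e).1 (val e).2 * ([set e] \subset perm_edges (@tour m j))%:R)
    + (1 - #|'I_m|%:R / t.+2%:R) * (c' (val e).1 (val e).2 *
         ([set e] \subset perm_edges (two_cycles m))%:R))); last first.
    by move=> e _; rewrite -mulr_sumr; ring.
  rewrite big_split /= -[X in X + _]mulr_sumr -[X in _ + X]mulr_sumr.
  transitivity (t.+2%:R^-1 * (\sum_(j < m) (4 * m%:R - 2))
      + (1 - #|'I_m|%:R / t.+2%:R) * (\sum_v cost v (two_cycles m v))%:R : R).
    congr (_ * _ + _ * _); last by rewrite permE' //; exact: two_cycles_neq.
    rewrite exchange_big; apply: eq_bigr => j _ /=.
    rewrite permE'; last exact: tour_neq.
    by rewrite -natrM -(sum_cost_tour j) natrD addrK.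
  rewrite sumr_const card_ord sum_cost_two_cycles natrM -[(_ - 2) *+ m]mulr_natl.
  have : t.+2%:R != 0 :> R by rewrite pnatr_eq0.
  by move: (t.+2%:R : R) (m%:R : R) => q x q0; field.
have [lp lpP] := sherali_adams_min (fun e : kedge (vertex m) => c' (val e).1 (val e).2)
  sys0 sys1 (ex_intro _ y yP).
(* The in-degree constraint sends one unit into the request [(ord_max, true)], and each edge
   entering it costs at least its service, which is [m]. *)
have lp_gt0 : 0 < lp.
  have [[z zP ->] _] := lpP.
  pose v : vertex m := (ord_max, true).
  have zin : ineq_ge (indic R (delta_in [set v])) 1 \in dfj_system R (vertex m).
    rewrite /dfj_system !mem_cat; do 2!(apply/orP; right).
    by apply/orP; left; apply: map_f; rewrite mem_enum.
  apply: lt_le_trans ltr01 (le_trans (sherali_adams_relaxes zP zin) _).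
  apply: ler_sum => e _ /=; rewrite ffunE.
  have z0 : 0 <= z [set e].
    have : (#|[set e]| <= t.+1)%N by rewrite cards1.
    by case/(sherali_adams_box sys0 sys1 zP)/andP.
  apply: ler_wpM2r => //; rewrite /c' ler_nat inE.
  case: (_ \notin _) => //=; rewrite inE; case: eqP => // ->.
  by rewrite /cost /v /dst /inpos /outpos /flip /= ltnn; lia.
exists (opt / lp); first by exists opt, lp.
have lp_le : lp <= 4 * m%:R - 2 * m%:R / t.+2%:R.
  by rewrite -ycost; apply: lpP.2; exists y.
have opt_ge0 : 0 <= opt.
  have m1 : 1 <= m%:R :> R by rewrite ler1n.
  by apply: le_trans opt_ge; lra.
apply: le_trans (_ : opt / (4 * m%:R - 2 * m%:R / t.+2%:R) <= _).
  by rewrite ler_wpM2r // invr_ge0; apply: le_trans lp_le; apply: ltW.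
by rewrite ler_wpM2l // lef_pV2 // posrE // (lt_le_trans lp_gt0).
Qed.

Theorem theorem6 (R : realType) :
  exists (eps0 c1 c2 : R) (nu : nat -> R -> nat),
    [/\ 0 < eps0, 0 < c1, 0 < c2 &
      forall (t : nat) (eps : R), 0 < eps -> eps < eps0 ->
        c1 * ((maxn t 1)%:R / eps) <= (nu t eps)%:R /\
        (nu t eps)%:R <= c2 * ((maxn t 1)%:R / eps) /\
        exists (V : finType) (E : rel V) (c c' : V -> V -> R) (r : R),
          [/\ #|V| = nu t eps,
              forall v w, E v w -> 0 <= c v w,
              metric_completion E c c',
              integrality_ratio t c' r
            & 1 + (1 - eps) / (2 * t + 3)%:R <= r]].
Proof.
(* This length satisfies [t.+2 < m * eps], which is what the final inequality asks for. *)
pose len (t : nat) (eps : R) := (Num.truncn (t.+2%:R / eps)).+1.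
(* The instance has [2 * (m + 2)] vertices. Multiplied by [eps < 1], this is at most
   [2 * t + 4 + 6 * eps], hence at most [12 * maxn t 1]; it is also larger than [t.+2], hence than
   [maxn t 1]. *)
exists 1, 1, 12, (fun t eps => 2 * len t eps + 4)%N; split=> // t eps eps0 eps1.
have tE : t.+2%:R = t%:R + 2 :> R by rewrite -addn2 natrD.
have t0 : 0 <= t%:R :> R by [].
have /andP[len_le len_gt] := truncn_itv (divr_ge0 (ler0n R t.+2) (ltW eps0)).
have {}len_le : (len t eps)%:R <= t.+2%:R / eps + 1.
  by rewrite /len -addn1 natrD lerD2r.
rewrite -/(len t eps) in len_gt.
set m := len t eps in len_le len_gt *.
have mE : t.+2%:R < m%:R * eps by rewrite -ltr_pdivrMr.
have m_pos : 0 < m%:R :> R by rewrite ltr0n.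
have tm : (t.+2 <= m)%N.
  rewrite -(ler_nat R); apply/ltW/(lt_trans mE).
  by rewrite gtr_pMr.
split; last split.
- rewrite mul1r ler_pdivrMr //; apply: le_trans (_ : m%:R * eps <= _).
    by apply/ltW/(le_lt_trans _ mE); rewrite ler_nat; lia.
  by rewrite ler_wpM2r ?(ltW eps0) // ler_nat; lia.
- have M1 : 1 <= (maxn t 1)%:R :> R by rewrite ler1n; lia.
  have Mt : t%:R <= (maxn t 1)%:R :> R by rewrite ler_nat; lia.
  rewrite mulrA ler_pdivlMr // natrD natrM.
  have : m%:R * eps <= t.+2%:R + eps.
    have := len_le; rewrite -(ler_pM2r eps0) mulrDl mul1r divfK //.
    by rewrite gt_eqF.
  rewrite tE; nra.
have [r rP r_ge] := instance_integrality_ratio R tm.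
(* The costs satisfy the triangle inequality, so the complete digraph is its own
   metric completion. *)
exists (vertex m), [rel v w | v != w], (fun u v => (cost u v)%:R),
  (fun u v => (cost u v)%:R), r; split=> //.
- by rewrite card_prod card_ord card_bool; lia.
- apply: metric_completion_triangle => u v w.
  by rewrite -natrD ler_nat cost_triangle.
apply: le_trans r_ge.
have -> : 4 * m%:R - 2 * m%:R / t.+2%:R = 2 * m%:R * (2 * t%:R + 3) / t.+2%:R :> R.
  by rewrite tE; field; lra.
rewrite natrD natrM ler_pdivlMr; last by rewrite divr_gt0 ?ltr0n // !mulr_gt0 //; lra.
have -> : (1 + (1 - eps) / (2 * t%:R + 3)) * (2 * m%:R * (2 * t%:R + 3) / t.+2%:R)
    = 2 * m%:R * (2 * t%:R + 4 - eps) / t.+2%:R.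
  by rewrite tE; field; apply/andP; split; lra.
(* After clearing the denominator, what remains amounts to [t + 2 <= m * eps]. *)
rewrite ler_pdivrMr ?ltr0n // tE.
rewrite tE in mE; lra.
Qed.
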